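(* Let $A$ be a unital separable C*-algebra and $\alpha$ a *-automorphism of $A$. Let $\{n_k\}_{k\ge1}$ and $\{m_j\}_{j\ge1}$ be increasing sequences of positive integers for which $n_k\mid n_{k+1}$ and $m_j\mid m_{j+1}$ for all $j,k\ge1$, and let $\delta(n_k)$ and $\delta(m_j)$ be the corresponding supernatural numbers. If $\delta(n_k)=\delta(m_j)$, then $\mathcal{B}_\alpha(\{n_k\})$ and $\mathcal{B}_\alpha(\{m_j\})$ are isomorphic.
   Context: The supernatural number $\delta(n_k)$ of $\{n_k\}$ assigns to each prime $p$ the supremum (in $\{0,1,\dots,\infty\}$) over $k$ of the exponent of $p$ in $n_k$. For $n\ge 1$, $A\times_{\alpha^n}\mathbb{Z}$ denotes the crossed product C*-algebra, generated by $A$ and a unitary $u_n$ with $u_n a u_n^*=\alpha^n(a)$ for $a\in A$. Put $\mathcal{B}_\alpha(n)=M_n(A\times_{\alpha^n}\mathbb{Z})$, with matrix units $e_{i,j}$, $0\le i,j\le n-1$. If $n\mid m$ and $k=m/n$, let $\gamma_{n,m}:\mathcal{B}_\alpha(n)\to\mathcal{B}_\alpha(m)$ be the injective unital *-homomorphism determined by $\gamma_{n,m}(ae_{0,0})=\sum_{l=0}^{k-1}\alpha^{ln}(a)e_{ln,ln}$ for $a\in A$, $\gamma_{n,m}(u_ne_{0,0})=u_me_{(k-1)n,0}+\sum_{l=0}^{k-2}e_{ln,(l+1)n}$, and $\gamma_{n,m}(e_{i,j})=\sum_{l=0}^{k-1}e_{i+ln,j+ln}$ for $0\le i,j\le n-1$.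 For an increasing sequence $\{n_k\}$ of positive integers with $n_k\mid n_{k+1}$, the Bunce-Deddens algebra of $\alpha$ is the C*-algebraic direct limit $\mathcal{B}_\alpha(\{n_k\})=\varinjlim(\mathcal{B}_\alpha(n_k),\gamma_{n_k,n_{k+1}})$. *)

(* Defs.v *)
From HB Require Import structures.
From mathcomp Require Import all_boot all_order all_algebra.
From mathcomp Require Import complex.
From mathcomp Require Import all_classical all_reals all_analysis.

Set Implicit Arguments.
Unset Strict Implicit.
Unset Printing Implicit Defensive.

Import Order.TTheory GRing.Theory Num.Theory.
Import numFieldNormedType.Exports.

Local Open Scope classical_set_scope.
Local Open Scope ring_scope.
Local Open Scope complex_scope.

(* Unital C*-algebras over the complex numbers R[i]; the zero algebra is
   included. The norm `|x| takes its values in R[i], where 0 <= z means that z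
   is a nonnegative real. Hierarchy-Builder admits no structure joining rings
   and normed modules (it would be a missing join with numDomainType), hence a
   record over a Banach space, whose carrier is then given its ring
   structure. *)
Record cstarAlgType (R : realType) := CStarAlgebra {
  cstar_banach : completeNormedModType R[i];
  cstar_one : cstar_banach;
  cstar_mul : cstar_banach -> cstar_banach -> cstar_banach;
  cstar_star : cstar_banach -> cstar_banach;
  cstar_mulA : associative cstar_mul;
  cstar_mul1 : left_id cstar_one cstar_mul;
  cstar_mulr1 : right_id cstar_one cstar_mul;
  cstar_mulDl : left_distributive cstar_mul +%R;
  cstar_mulDr : right_distributive cstar_mul +%R;
  cstar_scaleAl : forall (c : R[i]) (x y : cstar_banach),
    c *: cstar_mul x y = cstar_mul (c *: x) y;
  cstar_scaleAr : forall (c : R[i]) (x y : cstar_banach),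
    c *: cstar_mul x y = cstar_mul x (c *: y);
  cstar_starK : involutive cstar_star;
  cstar_starD : {morph cstar_star : x y / x + y};
  cstar_starZ : forall (c : R[i]) (x : cstar_banach),
    cstar_star (c *: x) = Num.conj c *: cstar_star x;
  cstar_starM : forall x y : cstar_banach,
    cstar_star (cstar_mul x y) = cstar_mul (cstar_star y) (cstar_star x);
  cstar_normM : forall x y : cstar_banach,
    `|cstar_mul x y| <= `|x| * `|y|;
  cstar_norm_star : forall x : cstar_banach,
    `|cstar_mul (cstar_star x) x| = `|x| ^+ 2
}.

Definition cstar_sort (R : realType) (A : cstarAlgType R) : Type :=
  cstar_banach A.
Coercion cstar_sort : cstarAlgType >-> Sortclass.

HB.instance Definition _ (R : realType) (A : cstarAlgType R) :=
  CompleteNormedModule.copy (cstar_sort A) (cstar_banach A).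
HB.instance Definition _ (R : realType) (A : cstarAlgType R) :=
  GRing.Zmodule_isPzRing.Build (cstar_sort A) (@cstar_mulA R A)
    (@cstar_mul1 R A) (@cstar_mulr1 R A) (@cstar_mulDl R A) (@cstar_mulDr R A).

Definition star (R : realType) (A : cstarAlgType R) (x : A) : A :=
  cstar_star x.
Arguments star {R A} x.

Section CStarTheory.
Variables (R : realType) (A : cstarAlgType R).
Implicit Types (c : R[i]) (x y : A).

Lemma cstar_scalerAl c x y : c *: (x * y) = (c *: x) * y.
Proof. exact: cstar_scaleAl. Qed.

Lemma cstar_scalerAr c x y : c *: (x * y) = x * (c *: y).
Proof. exact: cstar_scaleAr. Qed.

Lemma starK : involutive (@star R A).
Proof. exact: cstar_starK. Qed.

Lemma starD : {morph @star R A : x y / x + y}.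
Proof. exact: cstar_starD. Qed.

Lemma starZ c x : star (c *: x) = Num.conj c *: star x.
Proof. exact: cstar_starZ. Qed.

Lemma starM x y : star (x * y) = star y * star x.
Proof. exact: cstar_starM. Qed.

Lemma star1 : star (1 : A) = 1.
Proof. by rewrite -[RHS]starK -[in RHS](mul1r (star 1)) starM starK mul1r. Qed.

Lemma ler_cstar_normM x y : `|x * y| <= `|x| * `|y|.
Proof. exact: cstar_normM. Qed.

Lemma cstar_identity x : `|star x * x| = `|x| ^+ 2.
Proof. exact: cstar_norm_star. Qed.

End CStarTheory.

Definition separable (T : topologicalType) : Prop :=
  exists2 S : set T, countable S & dense S.

(* Unital *-homomorphisms; continuity is automatic between C*-algebras. *)
Definition star_hom (R : realType) (A B : cstarAlgType R) (f : A -> B) : Prop :=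
  [/\ linear f, monoid_morphism f & {morph f : x / star x}].

Definition star_iso (R : realType) (A B : cstarAlgType R) (f : A -> B) : Prop :=
  star_hom f /\ bijective f.

Definition isomorphic (R : realType) (A B : cstarAlgType R) : Prop :=
  exists f : A -> B, star_iso f.

Definition unitary (R : realType) (A : cstarAlgType R) (u : A) : Prop :=
  star u * u = 1 /\ u * star u = 1.

Definition covariant (R : realType) (A D : cstarAlgType R) (beta : A -> A)
    (f : A -> D) (v : D) : Prop :=
  [/\ star_hom f, unitary v
    & forall a, v * f a * star v = f (beta a)].

(* (D, iota, u) is the crossed product of A by the action of Z generated by
   beta: the universal C*-algebra generated by a copy of A and a unitary
   implementing beta. *)
Definition is_crossed_product (R : realType) (A : cstarAlgType R)
    (beta : A -> A) (D : cstarAlgType R) (iota : A -> D) (u : D) : Prop :=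
  covariant beta iota u /\
  forall (C : cstarAlgType R) (f : A -> C) (v : C), covariant beta f v ->
    exists! g : D -> C, [/\ star_hom g, forall a, g (iota a) = f a & g u = v].

(* theta identifies the *-algebra of n x n matrices over D with the C*-algebra
   E; as the C*-norm of a C*-algebra is unique, E is M_n(D) with its C*-norm.
   Scalars in R[i] act on 'M[D]_n entrywise. *)
Definition is_matrix_algebra (R : realType) (D : cstarAlgType R) (n : nat)
    (E : cstarAlgType R) (theta : 'M[D]_n -> E) : Prop :=
  [/\ bijective theta,
      {morph theta : M N / M + N},
      forall (c : R[i]) M, theta (map_mx ( *:%R c) M) = c *: theta M,
      theta 1%:M = 1 /\ {morph theta : M N / M *m N >-> M * N}
    & forall M, theta (map_mx star M^T) = star (theta M)].

(* x e_{i,j}, with natural numbers as indices; it is 0 if i or j is not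
   smaller than n. *)
Definition mxunit (D : pzRingType) (n i j : nat) (x : D) : 'M[D]_n :=
  \matrix_(r < n, c < n)
    (if (r == i :> nat) && (c == j :> nat) then x else 0).
Arguments mxunit {D} n i j x.

(* M_n of the crossed product of A by alpha^n. *)
Record matrix_crossed_product (R : realType) (A : cstarAlgType R)
    (alpha : A -> A) (n : nat) := MatrixCrossedProduct {
  crossed : cstarAlgType R;
  base_incl : A -> crossed;
  implementing : crossed;
  crossedP : is_crossed_product (iter n alpha) base_incl implementing;
  mxalg : cstarAlgType R;
  of_mx : 'M[crossed]_n -> mxalg;
  of_mxP : is_matrix_algebra of_mx }.
Arguments base_incl {R A alpha n} m a : rename.
Arguments of_mx {R A alpha n} m M : rename.

Definition is_connecting_map (R : realType) (A : cstarAlgType R)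
    (alpha : A -> A) (n m : nat)
    (X : matrix_crossed_product alpha n) (Y : matrix_crossed_product alpha m)
    (gamma : mxalg X -> mxalg Y) : Prop :=
  let k := (m %/ n)%N in
  [/\ star_hom gamma /\ injective gamma,
      forall a : A,
        gamma (of_mx X (mxunit n 0%N 0%N (base_incl X a))) =
        of_mx Y (\sum_(l < k)
          mxunit m (l * n)%N (l * n)%N (base_incl Y (iter (l * n)%N alpha a))),
      gamma (of_mx X (mxunit n 0%N 0%N (implementing X))) =
        of_mx Y (mxunit m (k.-1 * n)%N 0%N (implementing Y) +
                 \sum_(l < k.-1) mxunit m (l * n)%N (l.+1 * n)%N 1)
    & forall i j : 'I_n,
        gamma (of_mx X (mxunit n i j 1)) =
        of_mx Y (\sum_(l < k) mxunit m (i + l * n)%N (j + l * n)%N 1)].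

(* Direct limit of a sequence of unital C*-algebras with unital connecting
   *-homomorphisms. *)
Definition is_direct_limit (R : realType) (E : nat -> cstarAlgType R)
    (gamma : forall k, E k -> E k.+1)
    (B : cstarAlgType R) (phi : forall k, E k -> B) : Prop :=
  [/\ forall k, star_hom (phi k),
      forall k x, phi k.+1 (gamma k x) = phi k x
    & forall (C : cstarAlgType R) (psi : forall k, E k -> C),
        (forall k, star_hom (psi k)) ->
        (forall k x, psi k.+1 (gamma k x) = psi k x) ->
        exists! h : B -> C, star_hom h /\ forall k x, h (phi k x) = psi k x].

(* B is the Bunce-Deddens algebra of alpha along the sequence n_. All choices
   made here are unique up to isomorphism. *)
Definition is_bunce_deddens (R : realType) (A : cstarAlgType R)
    (alpha : A -> A) (n_ : nat -> nat) (B : cstarAlgType R) : Prop :=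
  exists (X : forall k, matrix_crossed_product alpha (n_ k))
         (gamma : forall k, mxalg (X k) -> mxalg (X k.+1))
         (phi : forall k, mxalg (X k) -> B),
    (forall k, is_connecting_map (gamma k)) /\ is_direct_limit gamma phi.

(* Increasing is taken in the wide sense. Sequences are indexed from 0. *)
Definition increasing_divisor_chain (n_ : nat -> nat) : Prop :=
  [/\ forall k, (0 < n_ k)%N,
      {homo n_ : k l / (k <= l)%N}
    & forall k, (n_ k %| n_ k.+1)%N].

(* The values lie in {0, 1, ..., +oo}, seen inside the extended reals. *)
Definition supernatural (R : realType) (n_ : nat -> nat) :
    {p : nat | prime p} -> \bar R :=
  fun p => ereal_sup (range (fun k => ((logn (val p) (n_ k))%:R)%:E)).
Arguments supernatural R n_ : clear implicits.

(* Main.v *)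
(* The algebra M_n(A x_{alpha^n} Z) is generated by the diagonal matrices with
   entries in A and by the unitary U = e_{0,1} + ... + e_{n-2,n-1} + u_n e_{n-1,0}.
   Extend a diagonal (d_0, ..., d_{n-1}) to a sequence with d_{r+n} = alpha^n(d_r);
   conjugation by U then shifts sequences, and M_n(A x_{alpha^n} Z) is universal
   for pairs of a *-homomorphism on these sequences and a unitary implementing
   the shift. If n | m, a sequence of this kind for n is also one for m, and
   gamma_{n,m} sends U to U and each sequence to itself. In the limit the
   sequences and U therefore do not depend on the stage, and when the two chains
   divide each other termwise, the identity on sequences and on U induces
   mutually inverse *-homomorphisms between the two limits. *)

Require Import Defs.
From HB Require Import structures.
From mathcomp Require Import all_boot all_order all_algebra.
From mathcomp Require Import complex.
From mathcomp Require Import all_classical all_reals all_analysis.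

Set Implicit Arguments.
Unset Strict Implicit.
Unset Printing Implicit Defensive.

Import Order.TTheory GRing.Theory Num.Theory.

Local Open Scope ring_scope.

(** * Adjoints and unitaries in a C*-algebra *)

Section Star.
Variables (R : realType) (A : cstarAlgType R).
Implicit Types x y : A.

Lemma star0 : star (0 : A) = 0.
Proof. by apply: (@addrI _ (star (0 : A))); rewrite -starD !addr0. Qed.

Lemma starN x : star (- x) = - star x.
Proof. by apply: (@addrI _ (star x)); rewrite -starD !subrr star0. Qed.

Lemma starB x y : star (x - y) = star x - star y.
Proof. by rewrite starD starN. Qed.

Lemma star_sum (I : Type) (r : seq I) (P : pred I) (F : I -> A) :
  star (\sum_(i <- r | P i) F i) = \sum_(i <- r | P i) star (F i).
Proof. by apply: big_morph; [exact: starD | exact: star0]. Qed.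

Lemma cstar_addxx_inj x y : x + x = y + y -> x = y.
Proof.
rewrite -!mulr2n -(scaler_nat 2 x) -(scaler_nat 2 y) => /scalerI; apply.
by rewrite pnatr_eq0.
Qed.

Lemma unitary_intertwine (U x y : A) :
  unitary U -> U * x * star U = y -> U * x = y * U.
Proof. by move=> [UU _] <-; rewrite -!mulrA UU mulr1. Qed.

Lemma unitaryX (U : A) k : unitary U -> unitary (U ^+ k).
Proof.
move=> [U1 U2]; elim: k => [|k [IH1 IH2]]; first by rewrite /unitary expr0 star1 mulr1.
by split; [rewrite exprS starM mulrA -(mulrA _ (star U)) U1 mulr1|
  rewrite exprSr starM mulrA -(mulrA _ U) U2 mulr1].
Qed.

Lemma commr_star_unitary (U x : A) :
  unitary U -> GRing.comm U x -> GRing.comm (star U) x.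
Proof.
move=> [U1 U2] cUx; rewrite /GRing.comm -[LHS]mulr1 -U2 mulrA -(mulrA _ x) -cUx.
by rewrite (mulrA _ U) U1 mul1r.
Qed.

(** [1 - 2p] is a self-adjoint involution. It carries facts about unitaries over to projections. *)
Lemma unitary_reflection (p : A) :
  star p = p -> p * p = p -> unitary (1 - (p + p)).
Proof.
move=> sp pp; rewrite /unitary starB starD star1 sp.
suff -> : (1 - (p + p)) * (1 - (p + p)) = 1 by [].
set q := p + p; have qq : q * q = q + q by rewrite mulrDr mulrDl pp.
by rewrite mulrBr mulr1 mulrBl mul1r qq (opprD q q) (addrA q) subrr sub0r opprK subrK.
Qed.
End Star.

(** * Unital *-homomorphisms *)

Section StarHom.
Variables (R : realType) (A B : cstarAlgType R) (f : A -> B).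
Hypothesis hf : star_hom f.

Lemma star_hom_linear (c : R[i]) (x y : A) : f (c *: x + y) = c *: f x + f y.
Proof. by case: hf => h _ _; rewrite h. Qed.

Lemma star_homD : {morph f : x y / x + y}.
Proof. by move=> x y; rewrite -[x]scale1r star_hom_linear !scale1r. Qed.

Lemma star_hom0 : f 0 = 0.
Proof. by apply: (@addrI _ (f 0)); rewrite -star_homD !addr0. Qed.

Lemma star_homZ (c : R[i]) (x : A) : f (c *: x) = c *: f x.
Proof. by rewrite -[c *: x]addr0 star_hom_linear star_hom0 addr0. Qed.

Lemma star_hom1 : f 1 = 1. Proof. by case: hf => _ []. Qed.

Lemma star_homM : {morph f : x y / x * y}.
Proof. by case: hf => _ []. Qed.

Lemma star_hom_star : {morph f : x / star x}.
Proof. by case: hf. Qed.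

Lemma star_hom_sum (I : Type) (r : seq I) (P : pred I) (F : I -> A) :
  f (\sum_(i <- r | P i) F i) = \sum_(i <- r | P i) f (F i).
Proof. by apply: big_morph; [exact: star_homD | exact: star_hom0]. Qed.

Lemma star_hom_unitary (u : A) : unitary u -> unitary (f u).
Proof. by case=> h1 h2; split; rewrite -star_hom_star -star_homM ?h1 ?h2 star_hom1. Qed.
End StarHom.

Lemma star_hom_id (R : realType) (A : cstarAlgType R) : star_hom (@id A).
Proof. by []. Qed.

Lemma star_hom_comp (R : realType) (A B C : cstarAlgType R)
    (g : B -> C) (f : A -> B) :
  star_hom g -> star_hom f -> star_hom (g \o f).
Proof.
move=> hg hf; split=> [c x y /=||x /=]; last by rewrite !star_hom_star.
  by rewrite !star_hom_linear.
by split=> [|x y] /=; rewrite ?star_hom1 ?star_homM.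
Qed.

Lemma star_hom_iter (R : realType) (A : cstarAlgType R) (f : A -> A) k :
  star_hom f -> star_hom (iter k f).
Proof. by move=> hf; elim: k => [|k IHk] //; apply: (star_hom_comp hf IHk). Qed.

Lemma star_hom_conj (R : realType) (A B : cstarAlgType R) (f : A -> B) (W : B) :
  star_hom f -> unitary W -> star_hom (fun x => W * f x * star W).
Proof.
move=> hf [W1 W2]; split=> [c x y||x] /=.
- by rewrite (star_hom_linear hf) mulrDr mulrDl -cstar_scalerAr -cstar_scalerAl.
- split=> [|x y]; first by rewrite (star_hom1 hf) mulr1.
  by rewrite (star_homM hf) !mulrA -(mulrA _ (star W) W) W1 mulr1.
- by rewrite /= (star_hom_star hf) !starM starK mulrA.
Qed.

(** * Uniqueness and commutation for maps out of a crossed product *)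

Section CrossedProduct.
Variables (R : realType) (A D : cstarAlgType R) (beta : A -> A).
Variables (iota : A -> D) (u : D).
Hypothesis hD : is_crossed_product beta iota u.

(** Both maps factor the same covariant pair, given by [g1 \o iota] and [g1 u], so the uniqueness
    clause identifies them. *)
Lemma crossed_hom_ext (E : cstarAlgType R) (g1 g2 : D -> E) :
  star_hom g1 -> star_hom g2 ->
  (forall a, g1 (iota a) = g2 (iota a)) -> g1 u = g2 u -> g1 = g2.
Proof.
case: hD => [[hi hu hc] univ] h1 h2 ga gu.
have cov : covariant beta (g1 \o iota) (g1 u).
  split; [exact: star_hom_comp | exact: star_hom_unitary |].
  by move=> a /=; rewrite -(star_hom_star h1) -!(star_homM h1) hc.
have [g [_ gU]] := univ E _ _ cov.
have <- : g = g1 by apply: gU; split=> // a; rewrite -ga.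
by apply: gU; split=> // a; rewrite -ga.
Qed.

Section Commutant.
Variables (E : cstarAlgType R) (g : D -> E).
Hypothesis hg : star_hom g.

(** Conjugating [g] by [W] gives a *-homomorphism with the same values on the generators, hence
    equal to [g]. *)
Lemma crossed_comm_unitary (W : E) :
  unitary W -> (forall a, GRing.comm W (g (iota a))) -> GRing.comm W (g u) ->
  forall x, GRing.comm W (g x).
Proof.
move=> hW Wa Wu x; apply: unitary_intertwine => //.
rewrite -[RHS]/(g x); have [_ W2] := hW.
rewrite -[g in RHS](crossed_hom_ext (star_hom_conj hg hW) hg) // => [a|].
  by rewrite Wa -mulrA W2 mulr1.
by rewrite Wu -mulrA W2 mulr1.
Qed.

(** The reflection [1 - 2p] is unitary and commutes with whatever [p] commutes with; dividing by 2
    recovers [p] from it. *)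
Lemma crossed_comm_projection (p : E) :
  star p = p -> p * p = p ->
  (forall a, GRing.comm p (g (iota a))) -> GRing.comm p (g u) ->
  forall x, GRing.comm p (g x).
Proof.
move=> sp pp pa pu x; rewrite /GRing.comm; apply: cstar_addxx_inj.
rewrite -mulrDl -mulrDr.
have comm1B y : GRing.comm y (g x) -> GRing.comm (1 - y) (g x).
  by move=> c; rewrite /GRing.comm mulrBl mulrBr mul1r mulr1 c.
rewrite -[p + p](subKr 1); apply: comm1B.
have cW y : GRing.comm p y -> GRing.comm (1 - (p + p)) y.
  by move=> c; rewrite /GRing.comm mulrBl mulrBr mul1r mulr1 mulrDl mulrDr c.
apply: crossed_comm_unitary => [|a|]; [exact: unitary_reflection|exact: cW|exact: cW].
Qed.

(* The universal property only gives commutation for unitaries. With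
   [q := star e], the unitary [1 - e q - q e + e + q] swaps the projections
   [e q] and [q e], and [e] is recovered as [e q (e + q)]. *)
Lemma crossed_comm_partial_isometry (e : E) :
  e * e = 0 -> e * star e * e = e ->
  (forall a, GRing.comm e (g (iota a))) ->
  (forall a, GRing.comm (star e) (g (iota a))) ->
  GRing.comm e (g u) -> GRing.comm (star e) (g u) ->
  forall x, GRing.comm e (g x).
Proof.
move=> ee eqe ea qa eu qu x.
set q := star e in qa qu eqe.
have sq : star q = e by rewrite /q starK.
have qq : q * q = 0 by rewrite -starM ee star0.
have qeq : q * e * q = q by move: (congr1 star eqe); rewrite !starM sq -/q mulrA.
have commM y z w : GRing.comm y w -> GRing.comm z w -> GRing.comm (y * z) w.
  by move=> cy cz; rewrite /GRing.comm -mulrA cz mulrA cy mulrA.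
have commD y z w : GRing.comm y w -> GRing.comm z w -> GRing.comm (y + z) w.
  by move=> cy cz; rewrite /GRing.comm mulrDl mulrDr cy cz.
have commB y z w : GRing.comm y w -> GRing.comm z w -> GRing.comm (y - z) w.
  by move=> cy cz; rewrite /GRing.comm mulrBl mulrBr cy cz.
have comm1 w : GRing.comm 1 w by rewrite /GRing.comm mul1r mulr1.
have cp : GRing.comm (e * q) (g x).
  apply: crossed_comm_projection => [||a|]; rewrite ?starM ?sq ?mulrA ?eqe //;
    exact: commM.
(* [s] is a self-adjoint partial isometry with support projection [p], so [1 - p + s] is
   self-adjoint and squares to 1. *)
pose p := e * q + q * e; pose s := e + q.
have ss : s * s = p by rewrite /s /p mulrDl !mulrDr ee qq add0r addr0.
have ps : p * s = s.
  by rewrite /p /s mulrDl !mulrDr -!mulrA ee qq !mulr0 add0r addr0 !mulrA eqe qeq.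
have sp : s * p = s.
  by rewrite /p /s mulrDl !mulrDr !mulrA ee qq !mul0r add0r addr0 eqe qeq.
have pp : p * p = p by rewrite -{2}ss mulrA ps ss.
have stp : star p = p by rewrite /p starD !starM sq.
have sts : star s = s by rewrite /s starD sq addrC.
have sqr1 (k t r : E) : k * t = 0 -> t * k = 0 -> k * k = k -> t * t = r ->
    k + r = 1 -> (k + t) * (k + t) = 1.
  by move=> kt tk kk tt kr; rewrite mulrDr !mulrDl kt tk kk tt addr0 add0r.
have cs : GRing.comm s (g x).
  have -> : s = (1 - p + s) - (1 - p) by rewrite [in RHS]addrC addKr.
  have cpx : GRing.comm (1 - p) (g x).
    apply: (commB) => //; apply: crossed_comm_projection => // [a|];
      apply: (commD); exact: commM.
  apply: (commB) => //; apply: crossed_comm_unitary => [|a|].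
  - suff WW : (1 - p + s) * (1 - p + s) = 1.
      by rewrite /unitary starD starB star1 stp sts.
    apply: (sqr1 _ _ p); rewrite ?subrK //.
    + by rewrite mulrBl mul1r ps subrr.
    + by rewrite mulrBr mulr1 sp subrr.
    + by rewrite mulrBr mulr1 [_ * p]mulrBl mul1r pp subrr subr0.
  - apply: (commD); last exact: commD.
    by apply: (commB) => //; apply: (commD); exact: commM.
  - apply: (commD); last exact: commD.
    by apply: (commB) => //; apply: (commD); exact: commM.
have -> : e = e * q * s by rewrite /s mulrDr eqe -mulrA qq mulr0 addr0.
exact: commM.
Qed.
End Commutant.
End CrossedProduct.

(** * Maps out of a matrix algebra from commuting matrix units *)

Section MatrixLift.
Variables (R : realType) (D E : cstarAlgType R) (n : nat).
Variables (g : D -> E) (F : 'I_n -> 'I_n -> E).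
Hypothesis hg : star_hom g.
Hypothesis FM : forall i j k l, F i j * F k l = if j == k then F i l else 0.
Hypothesis Fstar : forall i j, star (F i j) = F j i.
Hypothesis F1 : \sum_i F i i = 1.
Hypothesis Fcomm : forall i j x, GRing.comm (F i j) (g x).

(** This is [g] tensor [F] on [D] tensor [M_n]. The matrix units [F] commute with the image of [g],
    which makes the map multiplicative and *-preserving. *)
Definition mx_lift (M : 'M[D]_n) : E := \sum_i \sum_j g (M i j) * F i j.

Lemma mx_liftD : {morph mx_lift : M N / M + N}.
Proof.
move=> M N; rewrite /mx_lift -big_split; apply: eq_bigr => i _.
by rewrite -big_split; apply: eq_bigr => j _; rewrite mxE (star_homD hg) mulrDl.
Qed.

Lemma mx_liftZ (c : R[i]) M : mx_lift (map_mx ( *:%R c) M) = c *: mx_lift M.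
Proof.
rewrite /mx_lift scaler_sumr; apply: eq_bigr => i _.
by rewrite scaler_sumr; apply: eq_bigr => j _; rewrite mxE (star_homZ hg) cstar_scalerAl.
Qed.

Lemma mx_lift1 : mx_lift 1%:M = 1.
Proof.
rewrite -F1; apply: eq_bigr => i _; rewrite (bigD1 i) //= big1 ?addr0.
  by rewrite mxE eqxx (star_hom1 hg) mul1r.
by move=> j ji; rewrite mxE eq_sym (negPf ji) (star_hom0 hg) mul0r.
Qed.

Lemma mx_liftM : {morph mx_lift : M N / M *m N >-> M * N}.
Proof.
move=> M N; rewrite /mx_lift mulr_suml; apply: eq_bigr => i _.
rewrite mulr_suml.
under [RHS]eq_bigr => j _.
  rewrite mulr_sumr (bigD1 j) //= [X in _ + X]big1 => [|k kj]; last first.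
    rewrite mulr_sumr big1 // => l _.
    rewrite mulrA -(mulrA (g _)) Fcomm -!mulrA FM eq_sym (negPf kj) !mulr0 //.
  rewrite addr0 mulr_sumr.
  under eq_bigr => l _ do
    rewrite mulrA -(mulrA (g _)) Fcomm !mulrA -(star_homM hg) -mulrA FM eqxx.
  over.
rewrite exchange_big; apply: eq_bigr => l _.
by rewrite mxE (star_hom_sum hg) mulr_suml.
Qed.

Lemma mx_lift_star M : mx_lift (map_mx star M^T) = star (mx_lift M).
Proof.
rewrite /mx_lift exchange_big star_sum; apply: eq_bigr => i _.
rewrite star_sum; apply: eq_bigr => j _.
by rewrite !mxE starM Fstar -(star_hom_star hg) Fcomm.
Qed.

Lemma star_hom_mx_lift (X : cstarAlgType R) (theta : 'M[D]_n -> X) :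
  is_matrix_algebra theta ->
  exists2 G : X -> E, star_hom G & forall M, G (theta M) = mx_lift M.
Proof.
case=> [[inv thK invK] thD thZ [th1 thM] ths].
exists (mx_lift \o inv) => [|M]; last by rewrite /= thK.
split=> [c x y /=||x /=].
- by rewrite -[x]invK -[y]invK -thZ -thD !thK mx_liftD mx_liftZ.
- split=> [|x y] /=; first by rewrite -th1 thK mx_lift1.
  by rewrite -[x]invK -[y]invK -thM !thK mx_liftM.
- by rewrite -[x]invK -ths !thK mx_lift_star.
Qed.
End MatrixLift.

(** * Calculus of matrix entries *)

Section MatrixUnits.
Variables (R : realType) (D E : cstarAlgType R) (n : nat).
Variable theta : 'M[D]_n -> E.
Hypothesis hE : is_matrix_algebra theta.

Definition entry i j (x : D) : E := theta (mxunit n i j x).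

Let thD : {morph theta : M N / M + N}. Proof. by case: hE. Qed.

Let th0 : theta 0 = 0.
Proof. by apply: (@addrI _ (theta 0)); rewrite -thD !addr0. Qed.

Lemma matrix_algebra_sum (I : finType) (F : I -> 'M[D]_n) :
  theta (\sum_i F i) = \sum_i theta (F i).
Proof. exact: (big_morph _ thD th0). Qed.

Lemma entry_decomp M : theta M = \sum_(i < n) \sum_(j < n) entry i j (M i j).
Proof.
transitivity (theta (\sum_(i < n) \sum_(j < n) mxunit n i j (M i j))).
  congr theta; apply/matrixP => r c; rewrite summxE (bigD1 r) //= summxE (bigD1 c) //=.
  rewrite mxE !eqxx big1 => [|j jc]; last by rewrite mxE eqxx eq_sym val_eqE (negPf jc).
  rewrite addr0 big1 ?addr0 // => i ir.
  by rewrite summxE big1 // => j _; rewrite mxE eq_sym val_eqE (negPf ir).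
by rewrite matrix_algebra_sum; apply: eq_bigr => i _; rewrite matrix_algebra_sum.
Qed.

Lemma entryD i j : {morph entry i j : x y / x + y}.
Proof.
move=> x y; rewrite /entry -thD; congr theta; apply/matrixP => r c.
by rewrite !mxE; case: ifP; rewrite ?addr0.
Qed.

Lemma entryZ i j (c : R[i]) x : entry i j (c *: x) = c *: entry i j x.
Proof.
case: hE => _ _ thZ _ _; rewrite /entry -thZ; congr theta; apply/matrixP => r s.
by rewrite !mxE; case: ifP; rewrite ?scaler0.
Qed.

Lemma entry_star i j x : star (entry i j x) = entry j i (star x).
Proof.
case: hE => _ _ _ _ ths; rewrite /entry -ths; congr theta; apply/matrixP => r s.
by rewrite !mxE andbC; case: ifP; rewrite ?star0.
Qed.

(** A bound on the inner index suffices: an outer index out of range makes both sides 0. *)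
Lemma entryM i j k l x y : (j < n)%N ->
  entry i j x * entry k l y = if j == k then entry i l (x * y) else 0.
Proof.
case: hE => _ _ _ [_ thM] _ jn; rewrite /entry -thM.
case: eqP => [<-|jk]; rewrite -?th0; congr theta; apply/matrixP => r s.
  rewrite !mxE (bigD1 (Ordinal jn)) //= big1 ?addr0 => [|t tj].
    by rewrite !mxE /= eqxx andbT /=; do 2!case: ifP => //=; rewrite ?mul0r ?mulr0.
  by rewrite !mxE -val_eqE /= in tj *; rewrite (negPf tj) andbF mul0r.
rewrite !mxE big1 // => t _; rewrite !mxE.
case: (altP (t =P j :> nat)) => [->|_]; last by rewrite andbF mul0r.
by rewrite (introF eqP jk) mulr0.
Qed.

Lemma entry1 : \sum_(i < n) entry i i 1 = 1.
Proof.
case: hE => _ _ _ [th1 _] _; rewrite -th1 entry_decomp; apply: eq_bigr => i _.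
rewrite (bigD1 i) //= big1 ?addr0 ?mxE ?eqxx // => j ji.
rewrite mxE eq_sym (negPf ji) /entry -th0; congr theta; apply/matrixP => r s.
by rewrite !mxE if_same.
Qed.

(** Injectivity of the inner index [b] kills all cross terms. Diagonals, shifts and block sums are
    multiplied in this form. *)
Lemma sum_entryM (K : finType) (a b c : K -> nat) (x y : K -> D) :
  (forall l, b l < n)%N -> injective b ->
  (\sum_l entry (a l) (b l) (x l)) * (\sum_l entry (b l) (c l) (y l)) =
  \sum_l entry (a l) (c l) (x l * y l).
Proof.
move=> bn bI; rewrite mulr_suml; apply: eq_bigr => l _.
rewrite mulr_sumr (bigD1 l) //= entryM // eqxx big1 ?addr0 // => k kl.
by rewrite entryM // (inj_eq bI) eq_sym (negPf kl).
Qed.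

Lemma entry_conj i j r s x : (i < n)%N -> (j < n)%N ->
  entry r i 1 * entry i j x * entry j s 1 = entry r s x.
Proof. by move=> i_n j_n; rewrite entryM // eqxx entryM // eqxx mul1r mulr1. Qed.

End MatrixUnits.

(** * Quasiperiodic sequences and the shift *)

Section ShiftRep.
Variables (R : realType) (A : cstarAlgType R) (alpha : A -> A).
Implicit Types (d e : nat -> A) (n m : nat).

Definition quasiperiodic n d := forall r, d (r + n)%N = iter n alpha (d r).

(* A *-homomorphism on the quasiperiodic sequences, with a unitary implementing
   the shift; [M_n(A x_{alpha^n} Z)] is universal for these. *)
Definition shift_rep n (E : cstarAlgType R) (Delta : (nat -> A) -> E) (U : E) :=
  [/\ forall (c : R[i]) d e, Delta (fun r => c *: d r + e r) = c *: Delta d + Delta e,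
      Delta (fun=> 1) = 1
        /\ forall d e, Delta (fun r => d r * e r) = Delta d * Delta e,
      forall d, Delta (fun r => star (d r)) = star (Delta d),
      unitary U
    & forall d, quasiperiodic n d -> U * Delta d = Delta (fun r => d r.+1) * U].

Lemma quasiperiodicM n k d : quasiperiodic n d -> quasiperiodic (k * n) d.
Proof.
move=> dn r; elim: k => [|k IHk]; first by rewrite mul0n addn0.
by rewrite mulSn addnCA addnC dn IHk iterD.
Qed.

Lemma quasiperiodic_dvd n m d : (n %| m)%N -> quasiperiodic n d -> quasiperiodic m d.
Proof. by move=> /dvdnP[k ->]; exact: quasiperiodicM. Qed.

(** Sequences quasiperiodic for [n] are so for [m]; hence the shift relation at [n] is asked of
    fewer sequences. *)
Lemma shift_rep_dvd n m (E : cstarAlgType R) (Delta : (nat -> A) -> E) (U : E) :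
  (n %| m)%N -> shift_rep m Delta U -> shift_rep n Delta U.
Proof. by move=> nm [? ? ? ? h]; split=> // d /(quasiperiodic_dvd nm); exact: h. Qed.

Lemma shift_rep_hom n (E F : cstarAlgType R) (phi : E -> F)
    (Delta : (nat -> A) -> E) (U : E) :
  star_hom phi -> shift_rep n Delta U -> shift_rep n (phi \o Delta) (phi U).
Proof.
move=> hp [DZ [D1 DM] DS hU DU]; split=> /=.
- by move=> c d e; rewrite DZ (star_hom_linear hp).
- by split=> [|d e]; rewrite ?D1 ?(star_hom1 hp) // DM (star_homM hp).
- by move=> d; rewrite DS (star_hom_star hp).
- exact: star_hom_unitary.
- by move=> d dn; rewrite -!(star_homM hp) DU.
Qed.

Section Canonical.
Variables (n : nat) (X : matrix_crossed_product alpha n).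
Hypothesis n_gt0 : (0 < n)%N.
Local Notation T := (entry (of_mx X)).
Let hX := of_mxP X.

(** Only the first [n] terms of [d] are read, so the algebraic identities hold for all sequences;
    quasiperiodicity enters through the shift. *)
Definition mx_diag d : mxalg X := \sum_(r < n) T r r (base_incl X (d r)).

(** The coefficient of [U] in row [r]. In row [n - 1] the column [r.+1 %% n] returns to 0 and [u_n]
    appears. *)
Definition shift_weight r : crossed X := if r.+1 == n then implementing X else 1.

Definition mx_shift : mxalg X := \sum_(r < n) T r (r.+1 %% n) (shift_weight r).

Lemma star_hom_base : star_hom (base_incl X).
Proof. by have [[]] := crossedP X. Qed.

Lemma unitary_implementing : unitary (implementing X).
Proof. by have [[]] := crossedP X. Qed.

Lemma implementing_base a :
  implementing X * base_incl X a = base_incl X (iter n alpha a) * implementing X.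
Proof.
by have [[_ hu hc] _] := crossedP X; apply: unitary_intertwine.
Qed.

Lemma unitary_shift_weight r : unitary (shift_weight r).
Proof.
rewrite /shift_weight; case: ifP => _; first exact: unitary_implementing.
by rewrite /unitary star1 mulr1.
Qed.

Lemma star_mx_shift :
  star mx_shift = \sum_(r < n) T (r.+1 %% n) r (star (shift_weight r)).
Proof. by rewrite star_sum; apply: eq_bigr => r _; rewrite entry_star. Qed.

(** [mx_shift] is the permutation matrix of the cyclic successor, weighted by unitaries. *)
Lemma unitary_mx_shift : unitary mx_shift.
Proof.
have wP r := unitary_shift_weight r.
split; rewrite star_mx_shift sum_entryM //.
- rewrite -[RHS](entry1 hX) [RHS](reindex_inj (@ordS_inj n)).
  by apply: eq_bigr => r _; have [-> _] := wP r.
- exact: val_inj.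
- by rewrite -[RHS](entry1 hX); apply: eq_bigr => r _; have [_ ->] := wP r.
- by move=> r; rewrite ltn_mod.
- by move=> r s rs; apply: ordS_inj; apply: val_inj.
Qed.

(** Only the last row is not immediate: there [u_n] turns [d 0] into [alpha^n (d 0)], which is
    [d n]. *)
Lemma shift_weight_base d r : (r < n)%N -> quasiperiodic n d ->
  shift_weight r * base_incl X (d (r.+1 %% n)%N) = base_incl X (d r.+1) * shift_weight r.
Proof.
move=> rn dn; rewrite /shift_weight; case: eqP => [->|/eqP r1n].
  by rewrite modnn implementing_base -dn.
by rewrite modn_small ?mul1r ?mulr1 // ltn_neqAle r1n.
Qed.

Lemma mx_diag_shift_rep : shift_rep n mx_diag mx_shift.
Proof.
have hb := star_hom_base; split.
- move=> c d e; rewrite /mx_diag scaler_sumr -big_split; apply: eq_bigr => r _.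
  by rewrite (star_hom_linear hb) entryD // entryZ.
- split=> [|d e].
    by rewrite -[RHS](entry1 hX); apply: eq_bigr => r _; rewrite (star_hom1 hb).
  rewrite sum_entryM //; last exact: val_inj.
  by apply: eq_bigr => r _; rewrite (star_homM hb).
- move=> d; rewrite star_sum; apply: eq_bigr => r _.
  by rewrite entry_star // (star_hom_star hb).
- exact: unitary_mx_shift.
(* Reindexing the diagonal by the cyclic successor matches its rows with the columns of the
   shift. *)
- move=> d dn; rewrite /mx_shift /mx_diag [X in _ * X = _](reindex_inj (@ordS_inj n)).
  rewrite sum_entryM // => [|r|r s rs].
  + rewrite sum_entryM //; last exact: val_inj.
    by apply: eq_bigr => r _; rewrite shift_weight_base.
  + by rewrite ltn_mod.
  + by apply: ordS_inj; apply: val_inj.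
Qed.

End Canonical.
End ShiftRep.

(** * Two families of sequences that generate the diagonals *)

Section Universality.
Variables (R : realType) (A : cstarAlgType R) (alpha : A -> A).
Hypothesis h_alpha : star_hom alpha.
Variables (n : nat) (n_gt0 : (0 < n)%N).
Implicit Types (d e : nat -> A) (a : A).

Let h_iter k : star_hom (iter k alpha).
Proof. exact: star_hom_iter. Qed.

(** The quasiperiodic sequence whose first [n] terms are all [a]; its diagonal is the scalar matrix
    of [a]. *)
Definition orbit_seq a r : A := iter (r %/ n * n) alpha a.

(** For [i < n], the sequence whose diagonal is [e_{i,i}]. *)
Definition residue_ind i r : A := if (r %% n == i)%N then 1 else 0.

Lemma quasiperiodic_orbit_seq a : quasiperiodic alpha n (orbit_seq a).
Proof.
by move=> r; rewrite /orbit_seq divnDr // divnn n_gt0 mulnDl mul1n addnC iterD.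
Qed.

Lemma quasiperiodic_residue_ind i : quasiperiodic alpha n (residue_ind i).
Proof.
move=> r; rewrite /residue_ind modnDr; case: ifP => _.
  by rewrite (star_hom1 (h_iter n)).
by rewrite (star_hom0 (h_iter n)).
Qed.

Lemma residue_ind_add i r : (i < n)%N -> residue_ind i (r + i) = residue_ind 0 r.
Proof.
move=> i_n; rewrite /residue_ind; congr (if _ then _ else _).
by have := eqn_modDr i r 0 n; rewrite add0n (modn_small i_n) mod0n.
Qed.

(** Unless [n] divides [r] both sides vanish; if it does, [r] and [r + i] lie in the same block of
    length [n]. *)
Lemma orbit_seq_add a i r : (i < n)%N ->
  residue_ind 0 r * orbit_seq a (r + i) = residue_ind 0 r * orbit_seq a r.
Proof.
move=> i_n; rewrite /residue_ind; case: eqP => [r0|]; last by rewrite !mul0r.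
by rewrite /orbit_seq divnDl /dvdn ?r0 // (divn_small i_n) addn0.
Qed.

Lemma residue_ind_comm i r a : residue_ind i r * a = a * residue_ind i r.
Proof. by rewrite /residue_ind; case: ifP; rewrite ?mul1r ?mul0r ?mulr1 ?mulr0. Qed.

(** At [r] only [i = r %% n] survives, and quasiperiodicity carries [d i] to [d r]. This splits a
    diagonal into scalars times the [e_{i,i}]. *)
Lemma sum_orbit_residue d r : quasiperiodic alpha n d ->
  \sum_(i < n) orbit_seq (d i) r * residue_ind i r = d r.
Proof.
move=> dn; rewrite (bigD1 (Ordinal (ltn_pmod r n_gt0))) //= big1 => [|i ir].
  rewrite /residue_ind eqxx mulr1 addr0 /orbit_seq.
  by rewrite -(quasiperiodicM (r %/ n) dn) addnC -divn_eq.
by rewrite /residue_ind -val_eqE /= in ir *; rewrite eq_sym (negPf ir) mulr0.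
Qed.

(** * Maps are determined by the diagonals and the shift *)

Section Uniqueness.
Variables (X : matrix_crossed_product alpha n) (E : cstarAlgType R).
Variables (G1 G2 : mxalg X -> E).
Hypotheses (h1 : star_hom G1) (h2 : star_hom G2).
Hypothesis Gdiag : forall d, quasiperiodic alpha n d ->
  G1 (mx_diag X d) = G2 (mx_diag X d).
Hypothesis Gshift : G1 (mx_shift X) = G2 (mx_shift X).
Local Notation T := (entry (of_mx X)).
Let hX := of_mxP X.

Let agree x := G1 x = G2 x.

Let agreeM x y : agree x -> agree y -> agree (x * y).
Proof. by rewrite /agree (star_homM h1) (star_homM h2) => -> ->. Qed.

Let agree_star x : agree x -> agree (star x).
Proof. by rewrite /agree (star_hom_star h1) (star_hom_star h2) => ->. Qed.

Let agree_sum (K : finType) (F : K -> mxalg X) :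
  (forall l, agree (F l)) -> agree (\sum_l F l).
Proof.
move=> aF; rewrite /agree (star_hom_sum h1) (star_hom_sum h2).
by apply: eq_bigr => l _; exact: aF.
Qed.

Let T00 : T 0 0 1 = mx_diag X (residue_ind 0).
Proof.
have hb := star_hom_base X.
rewrite /mx_diag (bigD1 (Ordinal n_gt0)) //= big1 ?addr0 => [|r r0].
  by rewrite /residue_ind mod0n eqxx (star_hom1 hb).
rewrite /residue_ind modn_small // ifN_eq // (star_hom0 hb).
by rewrite -(scale0r (1 : crossed X)) entryZ // scale0r.
Qed.

Let T_shift r : (r < n)%N -> T 0 r 1 * mx_shift X = T 0 (r.+1 %% n) (shift_weight X r).
Proof.
move=> rn; rewrite mulr_sumr (bigD1 (Ordinal rn)) //= entryM // eqxx mul1r.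
rewrite big1 ?addr0 // => s sr; rewrite entryM //.
by rewrite -val_eqE /= eq_sym in sr; rewrite (negPf sr).
Qed.

(** [e_{0,r} = e_{0,0} U^r] for [r < n]: the weight [u_n] is not reached before column [n - 1]. *)
Let agree_row r : (r < n)%N -> agree (T 0 r 1).
Proof.
elim: r => [_|r IHr rn].
  by rewrite /agree T00; apply: Gdiag; exact: quasiperiodic_residue_ind.
have -> : T 0 r.+1 1 = T 0 r 1 * mx_shift X.
  by rewrite T_shift ?modn_small // ?(ltnW rn) // /shift_weight ltn_eqF.
by apply: agreeM => //; apply: IHr; exact: ltnW.
Qed.

Let agree_entry1 i j : (i < n)%N -> (j < n)%N -> agree (T i j 1).
Proof.
move=> i_n j_n.
have -> : T i j 1 = star (T 0 i 1) * T 0 j 1.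
  by rewrite entry_star // star1 entryM // mul1r.
by apply: agreeM; [apply: agree_star|]; exact: agree_row.
Qed.

(** The whole diagonal is used, not one corner, so that the embedding of the crossed product is
    unital and its universal property applies. *)
Let scalar (x : crossed X) : mxalg X := \sum_(i < n) T i i x.

Let star_hom_scalar : star_hom scalar.
Proof.
split=> [c x y||x].
- rewrite /scalar scaler_sumr -big_split; apply: eq_bigr => i _.
  by rewrite entryD // entryZ.
- split=> [|x y]; first exact: entry1.
  by rewrite /scalar sum_entryM //; exact: val_inj.
- by rewrite /scalar star_sum; apply: eq_bigr => i _; rewrite entry_star.
Qed.

(** The maps agree on all [e_{i,j}], and on scalar matrices by uniqueness for the crossed product;
    each entry is a scalar matrix times some [e_{i,j}]. *)
Lemma shift_rep_ext : G1 = G2.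
Proof.
have eq_scalar : G1 \o scalar = G2 \o scalar.
  apply: (crossed_hom_ext (crossedP X)) => [||a|].
  - exact: star_hom_comp.
  - exact: star_hom_comp.
  - rewrite /=; have -> : scalar (base_incl X a) = mx_diag X (orbit_seq a) :> mxalg X.
      by apply: eq_bigr => r _; rewrite /orbit_seq divn_small.
    by apply: Gdiag; exact: quasiperiodic_orbit_seq.
  - rewrite -[LHS]/(G1 _) -[RHS]/(G2 _); apply: agree_sum => i.
    have n1 : (n.-1 < n)%N by rewrite prednK.
    rewrite -(entry_conj hX i i _ n_gt0 n_gt0).
    apply: agreeM; last exact: agree_entry1.
    apply: agreeM; first exact: agree_entry1.
    (* One further shift from column [n - 1] wraps to column 0 and picks up [u_n]. *)
    have -> : T 0 0 (implementing X) = T 0 n.-1 1 * mx_shift X.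
      by rewrite T_shift // /shift_weight prednK // modnn eqxx.
    by apply: agreeM => //; exact: agree_row.
apply/funext => x; have [[inv _ invK] _ _ _ _] := hX.
rewrite -[x]invK (entry_decomp hX).
apply: agree_sum => i; apply: agree_sum => j; set y := inv x i j.
have -> : T i j y = scalar y * T i j 1.
  rewrite /scalar mulr_suml (bigD1 i) //= entryM // eqxx mulr1 big1 ?addr0 // => k ki.
  by rewrite entryM // val_eqE (negPf ki).
apply: agreeM; last exact: agree_entry1.
exact: (congr1 (@^~ y) eq_scalar).
Qed.

End Uniqueness.

(** * The map induced by a shift representation *)

Section Existence.
Variables (E : cstarAlgType R) (Delta : (nat -> A) -> E) (U : E).
Hypothesis rep : shift_rep alpha n Delta U.

Let DZ (c : R[i]) d e : Delta (fun r => c *: d r + e r) = c *: Delta d + Delta e.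
Proof. by case: rep. Qed.
Let D1 : Delta (fun=> 1) = 1. Proof. by case: rep => _ []. Qed.
Let DM d e : Delta (fun r => d r * e r) = Delta d * Delta e.
Proof. by case: rep => _ []. Qed.
Let DS d : Delta (fun r => star (d r)) = star (Delta d).
Proof. by case: rep. Qed.
Let hU : unitary U. Proof. by case: rep. Qed.
Let DU d : quasiperiodic alpha n d -> U * Delta d = Delta (fun r => d r.+1) * U.
Proof. by case: rep => _ _ _ _; apply. Qed.

Let DD d e : Delta (fun r => d r + e r) = Delta d + Delta e.
Proof.
by rewrite -[Delta d]scale1r -DZ; congr Delta; apply/funext => r; rewrite scale1r.
Qed.

Let D0 : Delta (fun=> 0) = 0.
Proof.
apply: (@addrI _ (Delta (fun=> 0))).
by rewrite [RHS]addr0 -DD; congr Delta; apply/funext => r; rewrite addr0.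
Qed.

Let D_sum (I : Type) (s : seq I) (F : I -> nat -> A) :
  Delta (fun r => \sum_(i <- s) F i r) = \sum_(i <- s) Delta (F i).
Proof.
elim: s => [|i s IHs].
  by rewrite big_nil -[RHS]D0; congr Delta; apply/funext => r; rewrite big_nil.
rewrite big_cons -IHs -DD; congr Delta; apply/funext => r; by rewrite big_cons.
Qed.

Let UX k : unitary (U ^+ k). Proof. exact: unitaryX. Qed.

Let UXU k x : star (U ^+ k) * (U ^+ k * x) = x.
Proof. by have [h _] := UX k; rewrite mulrA h mul1r. Qed.

Let UUX k x : U ^+ k * (star (U ^+ k) * x) = x.
Proof. by have [_ h] := UX k; rewrite mulrA h mul1r. Qed.

Let UD k d : quasiperiodic alpha n d ->
  U ^+ k * Delta d = Delta (fun r => d (r + k)%N) * U ^+ k.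
Proof.
elim: k d => [|k IHk] d dn.
  rewrite expr0 mul1r mulr1; congr Delta; apply/funext => r; by rewrite addn0.
rewrite exprSr -mulrA DU // mulrA IHk => [|r]; last by rewrite -addSn dn.
by rewrite -mulrA; congr (Delta _ * _); apply/funext => r; rewrite addnS.
Qed.

Let P i := Delta (residue_ind i).

Let PP i j : P i * P j = if i == j then P i else 0.
Proof.
rewrite /P -DM; case: eqP => [<-|ij]; [|rewrite -D0]; congr Delta; apply/funext => r;
  rewrite /residue_ind; case: eqP; rewrite ?mul1r ?mul0r // => ->.
by case: eqP.
Qed.

Let starP i : star (P i) = P i.
Proof.
rewrite /P -DS; congr Delta; apply/funext => r; rewrite /residue_ind.
by case: ifP; rewrite ?star1 ?star0.
Qed.

Let UP i : (i < n)%N -> U ^+ i * P i = P 0 * U ^+ i.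
Proof.
move=> i_n; rewrite /P UD; last exact: quasiperiodic_residue_ind.
by congr (Delta _ * _); apply/funext => r; exact: residue_ind_add.
Qed.

(** The candidate image of [e_{i,j}], modelled on [e_{0,j} = e_{0,0} U^j] for [j < n]. *)
Let F i j := star (U ^+ i) * P 0 * U ^+ j.

Let starF i j : star (F i j) = F j i.
Proof. by rewrite /F !starM starK starP mulrA. Qed.

Let Fr i j : (j < n)%N -> F i j = star (U ^+ i) * U ^+ j * P j.
Proof. by move=> jn; rewrite /F -!mulrA UP. Qed.

Let Fl i j : (i < n)%N -> F i j = P i * star (U ^+ i) * U ^+ j.
Proof.
by move=> i_n; rewrite -[LHS]starK starF Fr // !starM starP starK mulrA.
Qed.

Let FE i : (i < n)%N -> F i i = P i.
Proof. by move=> i_n; rewrite Fr //; have [-> _] := UX i; rewrite mul1r. Qed.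

Let FM i j k l : (j < n)%N -> (k < n)%N -> F i j * F k l = if j == k then F i l else 0.
Proof.
move=> jn kn; rewrite Fr // Fl // -!mulrA (mulrA (P j)) PP.
case: eqP => [<-|_]; last by rewrite mul0r !mulr0.
by rewrite (mulrA (U ^+ j)) UP // -!mulrA UUX mulrA.
Qed.

(** Passing [U ^+ i] or [U ^+ j] shifts the orbit sequence by less than [n], which is invisible
    under [residue_ind 0]. *)
Let comm_F_orbit i j a : (i < n)%N -> (j < n)%N ->
  GRing.comm (F i j) (Delta (orbit_seq a)).
Proof.
move=> i_n j_n; have qa := quasiperiodic_orbit_seq a; rewrite /GRing.comm /F.
transitivity (star (U ^+ i) * Delta (fun r => residue_ind 0 r * orbit_seq a r) * U ^+ j).
  rewrite -!mulrA UD // (mulrA (P 0)) -DM; congr (_ * (Delta _ * _)); apply/funext => r.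
  exact: orbit_seq_add.
have -> : (fun r => residue_ind 0 r * orbit_seq a r) =
          (fun r => orbit_seq a (r + i)%N * residue_ind 0 r).
  by apply/funext => r; rewrite -(orbit_seq_add a r i_n) residue_ind_comm.
rewrite DM !mulrA; congr (_ * _ * _).
have [_ h] := UX i.
by rewrite -[RHS](UXU i) (mulrA (U ^+ i)) UD // -mulrA h mulr1.
Qed.

Let comm_F_Un i j : GRing.comm (F i j) (U ^+ n).
Proof.
have cU k : GRing.comm (U ^+ k) (U ^+ n) by rewrite /GRing.comm -!exprD addnC.
have cUs k : GRing.comm (star (U ^+ k)) (U ^+ n) by exact: commr_star_unitary.
have cP : GRing.comm (P 0) (U ^+ n).
  rewrite /GRing.comm /P UD; last exact: quasiperiodic_residue_ind.
  by congr (Delta _ * _); apply/funext => r; rewrite /residue_ind modnDr.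
by rewrite /GRing.comm /F -mulrA cU mulrA -(mulrA (star _)) cP mulrA cUs -!mulrA.
Qed.

(** Shifting an orbit sequence by [n] applies [alpha^n] to [a], so [U ^+ n] takes the place of
    [u_n]. *)
Let covariant_orbit : covariant (iter n alpha) (Delta \o orbit_seq) (U ^+ n).
Proof.
split=> [||a /=]; last 1 first.
- rewrite UD; last exact: quasiperiodic_orbit_seq.
  have [_ h] := UX n; rewrite -mulrA h mulr1; congr Delta; apply/funext => r.
  by rewrite /orbit_seq divnDr // divnn n_gt0 mulnDl mul1n iterD.
- split=> [c a b /=||a /=].
  + by rewrite -DZ; congr Delta; apply/funext => r;
      rewrite /orbit_seq (star_hom_linear (h_iter _)).
  + split=> [|a b] /=.
      by rewrite -[RHS]D1; congr Delta; apply/funext => r;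
        rewrite /orbit_seq (star_hom1 (h_iter _)).
    by rewrite -DM; congr Delta; apply/funext => r;
      rewrite /orbit_seq (star_homM (h_iter _)).
  + by rewrite -DS; congr Delta; apply/funext => r;
      rewrite /orbit_seq (star_hom_star (h_iter _)).
- exact: UX.
Qed.

(** The covariant pair of orbit sequences and [U ^+ n] gives [g] on the crossed product; the matrix
    units [F] commute with its image and extend it to matrices. *)
Lemma shift_rep_lift (X : matrix_crossed_product alpha n) :
  exists G : mxalg X -> E,
    [/\ star_hom G, G (mx_shift X) = U
      & forall d, quasiperiodic alpha n d -> G (mx_diag X d) = Delta d].
Proof.
have [_ univ] := crossedP X.
have [g [[hg g_base g_impl] _]] := univ E _ _ covariant_orbit.
pose FF (i j : 'I_n) := F i j.
have FFM i j k l : FF i j * FF k l = if j == k then FF i l else 0 by exact: FM.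
have FFs i j : star (FF i j) = FF j i by exact: starF.
have FF1 : \sum_i FF i i = 1.
  rewrite (eq_bigr (fun i : 'I_n => P i)) => [|i _]; last exact: FE.
  rewrite -D_sum -D1; congr Delta; apply/funext => r.
  rewrite (bigD1 (Ordinal (ltn_pmod r n_gt0))) //= /residue_ind eqxx big1 ?addr0 // => i.
  by rewrite -val_eqE /= eq_sym => /negPf ->.
have FFbase i j a : GRing.comm (FF i j) (g (base_incl X a)).
  by rewrite g_base; exact: comm_F_orbit.
have FFimpl i j : GRing.comm (FF i j) (g (implementing X)).
  by rewrite g_impl; exact: comm_F_Un.
have FFcomm i j x : GRing.comm (FF i j) (g x).
  (* Diagonal units are projections, the others partial isometries of square zero: the two cases
     where commutation extends from the generators. *)
  have [<-|ij] := eqVneq i j.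
    by apply: (crossed_comm_projection (crossedP X)) => //; rewrite FFM eqxx.
  apply: (crossed_comm_partial_isometry (crossedP X)) => //.
  - by rewrite FFM eq_sym (negPf ij).
  - by rewrite FFs !FFM eqxx FFM eqxx.
  - by move=> a; rewrite FFs.
  - by rewrite FFs.
have [G hG GE] := star_hom_mx_lift hg FFM FFs FF1 FFcomm (of_mxP X).
have Gentry (i j : 'I_n) x : G (entry (of_mx X) i j x) = g x * FF i j.
  rewrite GE /mx_lift (bigD1 i) //= (bigD1 j) //= mxE !eqxx /=.
  rewrite big1 => [|k kj]; last first.
    by rewrite mxE eqxx val_eqE (negPf kj) (star_hom0 hg) mul0r.
  rewrite addr0 big1 ?addr0 // => k ki; rewrite big1 // => l _.
  by rewrite mxE val_eqE (negPf ki) (star_hom0 hg) mul0r.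
exists G; split=> // [|d dn].
(* [U] is split into the rows [FF r r * U]. In the last row [G] yields [F r 0 * U ^+ n], which is
   this row since [r.+1 = n]. *)
- rewrite (star_hom_sum hG) -[RHS]mul1r -FF1 mulr_suml; apply: eq_bigr => r _.
  rewrite (Gentry r (Ordinal (ltn_pmod r.+1 n_gt0))) /shift_weight /FF /=.
  case: eqP => [r1n|/eqP r1n].
    by rewrite g_impl -comm_F_Un r1n modnn /F -!mulrA expr0 mul1r -exprSr r1n.
  have rn : (r.+1 < n)%N by rewrite ltn_neqAle r1n /=.
  by rewrite (star_hom1 hg) mul1r modn_small // /F exprSr mulrA.
- rewrite (star_hom_sum hG) (eq_bigr (fun r : 'I_n =>
    Delta (fun s => orbit_seq (d r) s * residue_ind r s))) => [|r _].
    by rewrite -D_sum; congr Delta; apply/funext => r; exact: sum_orbit_residue.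
  by rewrite Gentry g_base /FF FE // DM.
Qed.

End Existence.
End Universality.

(** * Connecting maps preserve sequences and the shift *)

Section ConnectingMap.
Variables (R : realType) (A : cstarAlgType R) (alpha : A -> A).
Variables (n m : nat) (n_gt0 : (0 < n)%N) (m_gt0 : (0 < m)%N) (n_dvd_m : (n %| m)%N).
Variables (X : matrix_crossed_product alpha n) (Y : matrix_crossed_product alpha m).
Variable gamma : mxalg X -> mxalg Y.
Hypothesis conn : is_connecting_map gamma.
Local Notation k := (m %/ n)%N.
Local Notation TX := (entry (of_mx X)).
Local Notation TY := (entry (of_mx Y)).
Let hX := of_mxP X.
Let hY := of_mxP Y.

Let hg : star_hom gamma. Proof. by case: conn => [[]]. Qed.

Let mE : m = (k * n)%N. Proof. by rewrite divnK. Qed.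

Let k_gt0 : (0 < k)%N. Proof. by rewrite divn_gt0 // dvdn_leq. Qed.

Let kn_lt (l : 'I_k) i : (i < n)%N -> (i + l * n < m)%N.
Proof.
move=> i_n; rewrite [X in (_ < X)%N]mE; apply: (@leq_trans (l.+1 * n)).
  by rewrite mulSn ltn_add2r.
by rewrite leq_mul2r ltn_ord orbT.
Qed.

Let kn_inj i : injective (fun l : 'I_k => (i + l * n)%N).
Proof. by move=> l l' /eqP; rewrite eqn_add2l eqn_pmul2r // => /eqP /val_inj. Qed.

Let sum_blocks (F : nat -> mxalg Y) :
  \sum_(i < n) \sum_(l < k) F (i + l * n)%N = \sum_(r < m) F r.
Proof.
rewrite exchange_big -[RHS](big_mkord xpredT) [X in index_iota 0 X]mE big_nat_mul.
rewrite big_mkord.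
apply: eq_bigr => l _.
by rewrite -[X in index_iota X _]add0n big_addn mulSn addnK big_mkord.
Qed.

Let conn_unit (i j : nat) : (i < n)%N -> (j < n)%N ->
  gamma (TX i j 1) = \sum_(l < k) TY (i + l * n) (j + l * n) 1.
Proof.
move=> i_n j_n; have [_ _ _ /(_ (Ordinal i_n) (Ordinal j_n)) -> /=] := conn.
exact: matrix_algebra_sum.
Qed.

Let conn_base a : gamma (TX 0 0 (base_incl X a)) =
  \sum_(l < k) TY (0 + l * n) (0 + l * n) (base_incl Y (iter (l * n) alpha a)).
Proof. by have [_ -> _ _] := conn; exact: matrix_algebra_sum. Qed.

(** The separate [u_m] term becomes the summand [l = k - 1], whose column [k * n] is 0 modulo
    [m]. *)
Let conn_impl : gamma (TX 0 0 (implementing X)) =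
  \sum_(l < k) TY (0 + l * n) (l.+1 * n %% m)
    (if l.+1 == k then implementing Y else 1).
Proof.
have [_ _ -> _] := conn; case: hY => _ thD _ _ _; rewrite thD matrix_algebra_sum //.
have split_last q (G : nat -> mxalg Y) : (0 < q)%N ->
    \sum_(l < q) G l = G q.-1 + \sum_(l < q.-1) G l.
  by case: q => // q _; rewrite big_ord_recr addrC.
rewrite [RHS](split_last k (fun l => TY (0 + l * n) (l.+1 * n %% m)
  (if l.+1 == k then implementing Y else 1))) // prednK // eqxx -mE modnn; congr (_ + _).
apply: eq_bigr => l _; have lk : (l.+1 < k)%N by rewrite -ltn_predRL.
rewrite (ltn_eqF lk) modn_small // [X in (_ < X)%N]mE.
by rewrite ltn_mul2r n_gt0.
Qed.

(** Each diagonal entry is moved to the corner, where [gamma] is prescribed. Position [i + l * n] of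
    the image holds [alpha^(l n) (d i)], which is [d (i + l * n)]. *)
Lemma connecting_diag d : quasiperiodic alpha n d ->
  gamma (mx_diag X d) = mx_diag Y d.
Proof.
move=> dn; rewrite /mx_diag.
rewrite -(sum_blocks (fun r => TY r r (base_incl Y (d r)))) (star_hom_sum hg).
apply: eq_bigr => i _; rewrite -(entry_conj hX i i _ n_gt0 n_gt0) !(star_homM hg).
rewrite !conn_unit // conn_base sum_entryM // => [|l]; last exact: kn_lt.
rewrite sum_entryM // => [|l]; last exact: kn_lt.
by apply: eq_bigr => l _; rewrite mul1r mulr1 (quasiperiodicM l dn).
Qed.

(** Rows [i < n - 1] give the steps inside the blocks of length [n]; the last row, through the image
    of [u_n], gives the steps from block to block and the final return with [u_m]. *)
Lemma connecting_shift : gamma (mx_shift X) = mx_shift Y.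
Proof.
rewrite /mx_shift -(sum_blocks (fun r => TY r (r.+1 %% m) (shift_weight Y r))).
rewrite (star_hom_sum hg); apply: eq_bigr => i _; rewrite /shift_weight.
case: eqP => [i1n|/eqP i1n].
  rewrite i1n modnn -[implementing X]mul1r.
  have -> : TX i 0 (1 * implementing X) = TX i 0 1 * TX 0 0 (implementing X).
    by rewrite entryM.
  rewrite (star_homM hg) conn_unit // conn_impl sum_entryM // => [|l]; last exact: kn_lt.
  apply: eq_bigr => l _; rewrite mul1r -addSn i1n -mulSn.
  by rewrite -[l.+1 == k](eqn_pmul2r n_gt0) -mE.
have i1 : (i.+1 < n)%N by rewrite ltn_neqAle i1n /=.
rewrite modn_small // conn_unit //; apply: eq_bigr => l _.
by rewrite -addSn modn_small ?(ltn_eqF (kn_lt l i1)) ?kn_lt.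
Qed.

End ConnectingMap.

(** * Divisibility from equal supernatural numbers *)

Lemma dvdn_chain n_ : increasing_divisor_chain n_ ->
  {homo n_ : i j / (i <= j)%N >-> (i %| j)%N}.
Proof.
case=> _ _ dvd_n; apply: homo_leq => [x|y x z|];
  [exact: dvdnn|exact: dvdn_trans|exact: dvd_n].
Qed.

(** A finite exponent below a supremum of integers is reached by some [m_ j]; finitely many primes
    divide [n_ k], so one [j] serves them all. *)
Lemma supernatural_dvd (R : realType) (n_ m_ : nat -> nat) :
  increasing_divisor_chain n_ -> increasing_divisor_chain m_ ->
  supernatural R n_ = supernatural R m_ ->
  forall k, exists j, (n_ k %| m_ j)%N.
Proof.
move=> n_chain m_chain eq_delta k.
have m_mono := dvdn_chain m_chain; have [n_gt0 _ _] := n_chain.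
have [m_gt0 _ _] := m_chain.
have pointwise p : prime p -> exists j, (logn p (n_ k) <= logn p (m_ j))%N.
  move=> pp; apply: contrapT => /forallNP no_j.
  have := congr1 (@^~ (exist _ p pp)) eq_delta; rewrite /supernatural /= => eq_p.
  (* If every [m_ j] had a smaller exponent, the common supremum would be at most the
     predecessor. *)
  have : (((logn p (n_ k))%:R : R)%:E <= ((logn p (n_ k)).-1%:R : R)%:E)%E.
    apply: (@le_trans _ _ (ereal_sup (range (fun i => ((logn p (n_ i))%:R : R)%:E)))).
      by apply: ereal_sup_ubound; exists k.
    rewrite eq_p; apply: ge_ereal_sup => _ [j _ <-]; rewrite lee_fin ler_nat.
    have /negP := no_j j; rewrite -ltnNge => lt_j.
    by rewrite -ltnS (ltn_predK lt_j).
  (* The index 0 shows that the exponent is positive, so its truncated predecessor is strictly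
     smaller. *)
  have /negP := no_j 0%N; rewrite -ltnNge => lt_0.
  by rewrite lee_fin ler_nat -ltnS (ltn_predK lt_0) ltnn.
have [j hj] : exists j, forall p, p \in primes (n_ k) ->
    (logn p (n_ k) <= logn p (m_ j))%N.
  have : all prime (primes (n_ k)) by apply/allP => p; rewrite mem_primes => /andP[].
  elim: (primes (n_ k)) => [_|p s IHs /= /andP[pp /IHs[j hj]]]; first by exists 0%N.
  have [i hi] := pointwise p pp; exists (maxn i j) => q; rewrite inE => /predU1P[->|qs].
    by apply: (leq_trans hi); apply: dvdn_leq_log; rewrite ?m_gt0 ?m_mono ?leq_maxl.
  by apply: (leq_trans (hj q qs)); apply: dvdn_leq_log; rewrite ?m_gt0 ?m_mono ?leq_maxr.
exists j; apply/dvdn_partP => // p; rewrite p_part => p_n.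
by rewrite pfactor_dvdn ?m_gt0 ?hj //; move: p_n; rewrite mem_primes => /andP[].
Qed.

(** * Sequences and the shift in the direct limit *)

Section LimitFacts.
Variables (R : realType) (A : cstarAlgType R) (alpha : A -> A).
Hypothesis h_alpha : star_hom alpha.
Variables (n_ : nat -> nat) (n_chain : increasing_divisor_chain n_).
Variables (B : cstarAlgType R) (X : forall k, matrix_crossed_product alpha (n_ k)).
Variables (gamma : forall k, mxalg (X k) -> mxalg (X k.+1)).
Variable phi : forall k, mxalg (X k) -> B.
Arguments gamma : clear implicits.
Arguments phi : clear implicits.
Hypothesis conn : forall k, is_connecting_map (gamma k).
Hypothesis lim : is_direct_limit gamma phi.

Let n_gt0 k : (0 < n_ k)%N. Proof. by case: n_chain. Qed.
Let n_dvd k : (n_ k %| n_ k.+1)%N. Proof. by case: n_chain. Qed.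
Let hphi k : star_hom (phi k). Proof. by case: lim. Qed.

Let phi_gamma k x : phi k.+1 (gamma k x) = phi k x.
Proof. by have [_ h _] := lim; exact: (h k). Qed.

Let gamma_shift k : gamma k (mx_shift (X k)) = mx_shift (X k.+1).
Proof. exact: connecting_shift. Qed.

Let gamma_diag k d : quasiperiodic alpha (n_ k) d ->
  gamma k (mx_diag (X k) d) = mx_diag (X k.+1) d.
Proof. exact: connecting_diag. Qed.

Lemma limit_shift k : phi k (mx_shift (X k)) = phi 0 (mx_shift (X 0)).
Proof. by elim: k => // k <-; rewrite -gamma_shift phi_gamma. Qed.

Lemma limit_diag k l d :
  quasiperiodic alpha (n_ k) d -> quasiperiodic alpha (n_ l) d ->
  phi k (mx_diag (X k) d) = phi l (mx_diag (X l) d).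
Proof.
wlog kl : k l / (k <= l)%N => [hw|] qk ql.
  by case/orP: (leq_total k l) => ?; [exact: hw | apply/esym; exact: hw].
elim: l kl {ql} => [|l IHl]; first by rewrite leqn0 => /eqP <-.
rewrite leq_eqVlt => /predU1P[<- //|]; rewrite ltnS => kl.
rewrite IHl // -phi_gamma gamma_diag //.
exact: quasiperiodic_dvd (dvdn_chain n_chain kl) qk.
Qed.

(** The maps agree on every stage, since diagonals and the shift determine a map there; uniqueness
    for the limit concludes. *)
Lemma limit_ext (C : cstarAlgType R) (h1 h2 : B -> C) :
  star_hom h1 -> star_hom h2 ->
  h1 (phi 0 (mx_shift (X 0))) = h2 (phi 0 (mx_shift (X 0))) ->
  (forall k d, quasiperiodic alpha (n_ k) d ->
    h1 (phi k (mx_diag (X k) d)) = h2 (phi k (mx_diag (X k) d))) ->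
  h1 = h2.
Proof.
move=> hh1 hh2 h_shift h_diag; have [_ _ univ] := lim.
have [k|k x|h [_ hU]] := univ C (fun k => h1 \o phi k).
- exact: star_hom_comp.
- by rewrite /= phi_gamma.
have <- : h = h1 by apply: hU.
apply: hU; split=> // k x.
have -> // : h1 \o phi k = h2 \o phi k.
apply: (shift_rep_ext h_alpha (n_gt0 k)) => [||d dn|]; try exact: star_hom_comp.
- exact: h_diag.
- by rewrite /= limit_shift.
Qed.

End LimitFacts.

(** * The map between two limits *)

Section LimitMap.
Variables (R : realType) (A : cstarAlgType R) (alpha : A -> A).
Hypothesis h_alpha : star_hom alpha.
Variables (n_ : nat -> nat) (n_chain : increasing_divisor_chain n_).
Variables (B : cstarAlgType R) (X : forall k, matrix_crossed_product alpha (n_ k)).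
Variables (gamma : forall k, mxalg (X k) -> mxalg (X k.+1)).
Variable phi : forall k, mxalg (X k) -> B.
Arguments gamma : clear implicits.
Arguments phi : clear implicits.
Hypothesis conn : forall k, is_connecting_map (gamma k).
Hypothesis lim : is_direct_limit gamma phi.

Variables (m_ : nat -> nat) (m_chain : increasing_divisor_chain m_).
Variables (C : cstarAlgType R) (Y : forall k, matrix_crossed_product alpha (m_ k)).
Variables (delta : forall k, mxalg (Y k) -> mxalg (Y k.+1)).
Variable psi : forall k, mxalg (Y k) -> C.
Arguments delta : clear implicits.
Arguments psi : clear implicits.
Hypothesis conn' : forall k, is_connecting_map (delta k).
Hypothesis lim' : is_direct_limit delta psi.
Hypothesis n_dvd_m : forall k, exists j, (n_ k %| m_ j)%N.

(** If [n_ k] divides [m_ j], the canonical pair of stage [j], pushed into [C], is a shift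
    representation for [n_ k] and lifts to stage [k]. The lifts are compatible because they agree on
    diagonals and the shift. *)
Lemma limit_map : exists h : B -> C,
  [/\ star_hom h, h (phi 0 (mx_shift (X 0))) = psi 0 (mx_shift (Y 0))
    & forall k j d, quasiperiodic alpha (n_ k) d -> quasiperiodic alpha (m_ j) d ->
        h (phi k (mx_diag (X k) d)) = psi j (mx_diag (Y j) d)].
Proof.
have [n_gt0 _ n_dvd] := n_chain; have [m_gt0 _ _] := m_chain.
have [hpsi _ _] := lim'.
have stage k : exists G : mxalg (X k) -> C,
    [/\ star_hom G, G (mx_shift (X k)) = psi 0 (mx_shift (Y 0))
      & forall j d, quasiperiodic alpha (n_ k) d -> quasiperiodic alpha (m_ j) d ->
          G (mx_diag (X k) d) = psi j (mx_diag (Y j) d)].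
  have [j n_m] := n_dvd_m k.
  have rep := shift_rep_hom (hpsi j) (mx_diag_shift_rep (Y j) (m_gt0 j)).
  have [G [hG G_shift G_diag]] :=
    shift_rep_lift h_alpha (n_gt0 k) (shift_rep_dvd n_m rep) (X k).
  exists G; split=> // [|i d dn dm].
    by rewrite G_shift (limit_shift m_chain conn' lim').
  rewrite G_diag //=; apply: (limit_diag m_chain conn' lim') => //.
  exact: quasiperiodic_dvd n_m dn.
pose G k := projT1 (cid (stage k)).
have GP k : [/\ star_hom (G k), G k (mx_shift (X k)) = psi 0 (mx_shift (Y 0))
    & forall j d, quasiperiodic alpha (n_ k) d -> quasiperiodic alpha (m_ j) d ->
        G k (mx_diag (X k) d) = psi j (mx_diag (Y j) d)].
  exact: projT2 (cid (stage k)).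
have [_ _ univ] := lim.
have [k|k x|h [[hh hphi] _]] := univ C G.
- by have [] := GP k.
- have [hG1 s1 d1] := GP k.+1; have [hG0 s0 d0] := GP k.
  have hgam : star_hom (gamma k) by have [[]] := conn k.
  have -> // : G k = G k.+1 \o gamma k.
  apply: (shift_rep_ext h_alpha (n_gt0 k)) => // [|d dn|].
  + exact: star_hom_comp.
  (* A [j] chosen for [k.+1] also serves [k], as [n_ k] divides [n_ k.+1]. *)
  + have [j n_m] := n_dvd_m k.+1.
    have dn1 := quasiperiodic_dvd (n_dvd k) dn.
    rewrite /= (connecting_diag (n_gt0 k) (n_dvd k) (conn k)) // (d1 j) //.
      by rewrite (d0 j) //; exact: quasiperiodic_dvd n_m dn1.
    exact: quasiperiodic_dvd n_m dn1.
  + by rewrite /= (connecting_shift (n_gt0 k) (n_gt0 k.+1) (n_dvd k) (conn k)) s1.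
exists h; split=> // [|k j d dn dm]; rewrite hphi; first by have [_ ->] := GP 0.
by have [_ _ h_diag] := GP k; exact: h_diag.
Qed.

End LimitMap.

(** * The two limit maps are mutually inverse *)

Theorem proposition2p10 (R : realType) (A : cstarAlgType R)
    (A_separable : separable A)
    (alpha : A -> A) (alpha_aut : star_iso alpha)
    (n_ m_ : nat -> nat)
    (n_chain : increasing_divisor_chain n_)
    (m_chain : increasing_divisor_chain m_)
    (eq_delta : supernatural R n_ = supernatural R m_)
    (B C : cstarAlgType R)
    (B_def : is_bunce_deddens alpha n_ B)
    (C_def : is_bunce_deddens alpha m_ C) :
  isomorphic B C.
Proof.
have [h_alpha _] := alpha_aut.
have [X [gamma [phi [conn lim]]]] := B_def.
have [Y [delta [psi [conn' lim']]]] := C_def.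
have n_m := supernatural_dvd n_chain m_chain eq_delta.
have m_n := supernatural_dvd m_chain n_chain (esym eq_delta).
have [h [hh h_shift h_diag]] :=
  limit_map h_alpha n_chain conn lim m_chain conn' lim' n_m.
have [g [hg g_shift g_diag]] :=
  limit_map h_alpha m_chain conn' lim' n_chain conn lim m_n.
have gh : g \o h = id.
  apply: (limit_ext h_alpha n_chain conn lim (star_hom_comp hg hh) (star_hom_id B)).
    by rewrite /= h_shift g_shift.
  (* With [n_ k] dividing [m_ j], the sequence [d] lives at stages of both chains, so [h] and then
     [g] return it unchanged. *)
  move=> k d dn; have [j n_dvd_m] := n_m k.
  have dm := quasiperiodic_dvd n_dvd_m dn.
  by rewrite /= (h_diag k j) // (g_diag j k).
have hgK : h \o g = id.
  apply: (limit_ext h_alpha m_chain conn' lim' (star_hom_comp hh hg) (star_hom_id C)).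
    by rewrite /= g_shift h_shift.
  move=> k d dm; have [j m_dvd_n] := m_n k.
  have dn := quasiperiodic_dvd m_dvd_n dm.
  by rewrite /= (g_diag k j) // (h_diag j k).
exists h; split=> //; exists g => x.
- exact: (congr1 (@^~ x) gh).
- exact: (congr1 (@^~ x) hgK).
Qed.
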